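(* Let $d\ge1$ and let $Z\subseteq\mathbb{R}^d$ be the outcome space of a discrete multicriteria optimization problem, i.e. the set $N$ of nondominated points of $Z$ is finite and nonempty. Let $n=|N|$, and let $m$ be the number of nontrivial extremal generators of $\overline{W}(N)$, i.e. those (up to tropical scaling) which are not in $\mathcal{E}_{\min}$. Then the Nondominated Set Algorithm described in the context, applied to $Z$, terminates after exactly $n+m$ iterations of its while-loop and returns $N$, regardless of the choices made in the algorithm.
   Context: A point $z\in Z\subseteq\mathbb{R}^d$ is nondominated if there is no $w\in Z$ with $w_i\le z_i$ for all $i\in[d]=\{1,\dots,d\}$ and $w_\ell<z_\ell$ for at least one $\ell$. $\mathbb{T}_{\min}=\mathbb{R}\cup\{\infty\}$ with tropical addition $\min$ and tropical multiplication $+$; $\mathbb{T}_{\max}=\mathbb{R}\cup\{-\infty\}$ with $\max$ and $+$. Both carry the order topology, and powers the product topology. Coordinates in $\mathbb{T}_{\min}^{d+1}$, $\mathbb{T}_{\max}^{d+1}$ are indexed by $0,\dots,d$. $\operatorname{supp}(a)$ is the set of indices $i$ with $a_i\neq\infty$ (for $a\in\mathbb{T}_{\min}^{d+1}$), respectively $a_i\neq-\infty$ (for $a\in\mathbb{T}_{\max}^{d+1}$). A $\min$-tropical cone is a nonempty $C\subseteq\mathbb{T}_{\min}^{d+1}$ such that $(\min(\lambda+x_i,\mu+y_i))_i\in C$ for all $x,y\in C$, $\lambda,\mu\in\mathbb{T}_{\min}$. A set generates $C$ if $C$ is the smallest $\min$-tropical cone containing it. A finitely generated cone has an inclusion-minimal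 generating set, unique up to tropical scaling (adding real multiples of the all-ones vector $\mathbf{1}$); its elements are the extremal generators. $e^{(i)}\in\mathbb{T}_{\min}^{d+1}$ has $i$-th entry $0$ and all others $\infty$; $\mathcal{E}_{\min}=\{e^{(1)},\dots,e^{(d)}\}$. For finite $G\subset\mathbb{T}_{\max}^{d+1}$ with $0\in\operatorname{supp}(g)$ for all $g\in G$, let $M(G)=\bigcup_{g\in G}\{x\in\mathbb{R}^{d+1} : x_0-g_0\le\min(x_j-g_j\mid j\in\operatorname{supp}(g)\setminus\{0\})\}$; let $W(G)$ be the closure in $\mathbb{R}^{d+1}$ of $\mathbb{R}^{d+1}\setminus M(G)$, and $\overline{W}(G)$ the closure of $W(G)$ in $\mathbb{T}_{\min}^{d+1}$; for the sets $G$ occurring here it is a finitely generated $\min$-tropical cone. Points of $\mathbb{R}^d$ are identified with points of $\mathbb{R}^{d+1}$ with $0$th coordinate $0$. Extremal generators of $\overline{W}(G)$ with finite $0$th coordinate are always normalized to have $0$th coordinate $0$; those with $0$th coordinate $\infty$ are the elements of $\mathcal{E}_{\min}$. Subroutine NewExtremals$(G,A,h)$, where $A$ is the set of extremal generators of $\overline{W}(G)$ and $h\in\mathbb{R}^{d+1}$ with $h_0=0$: let $A^{\ge}=\{a\in A : a_0\ge\min_{i\in[d]}(a_i-h_i)\}$ and start with $B=A^{\ge}$. For every pair $b\in A^{\ge}$, $c\in A\setminus A^{\ge}$, set $\lambda=-\min_{i\in[d]}(b_i-h_i)$ and $a=\min(\lambda\mathbf{1}+b,\,c)$ (componentwise);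 if $a$ is an extremal generator of $\overline{W}(G\cup\{h\})$, add $(0,a_1-a_0,\dots,a_d-a_0)$ to $B$. Return $B$. Oracle NextNonDominated$(Z,a)$, for $a\in\mathbb{T}_{\min}^{d+1}$ with $a_0=0$: returns some nondominated point $z$ of $Z$ with $z_j<a_j$ for all $j\in\operatorname{supp}(a)\setminus\{0\}$ if such a point exists, and None otherwise. Nondominated Set Algorithm: initialize $A=\mathcal{E}_{\min}\cup\{e^{(0)}\}$, $G=\emptyset$, $\Omega=\mathcal{E}_{\min}$. While $A\ne\Omega$: pick any $a\in A\setminus\Omega$; let $g=$ NextNonDominated$(Z,a)$; if $g\ne$ None, replace $A$ by NewExtremals$(G,A,g)$ and then $G$ by $G\cup\{g\}$; otherwise replace $\Omega$ by $\Omega\cup\{a\}$. Finally return $G$. *)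

(* Defs.v *)
From mathcomp Require Import all_boot all_order all_algebra.
From mathcomp Require Import all_classical all_reals all_analysis.

Set Implicit Arguments.
Unset Strict Implicit.
Unset Printing Implicit Defensive.

Import Order.TTheory GRing.Theory Num.Theory.
Import numFieldNormedType.Exports.

Local Open Scope classical_set_scope.
Local Open Scope ring_scope.

Definition nondominated (R : realType) (d : nat) (Z : set 'rV[R]_d) :
    set 'rV[R]_d :=
  [set z | Z z /\ ~ exists w, [/\ Z w, (forall i, w 0 i <= z 0 i) &
                                  exists l, w 0 l < z 0 l]].

(* T_min is \bar R without -oo and T_max is \bar R without +oo; their order
   topologies are the ones induced by the order topology of \bar R.  Row vectors
   carry the product topology.  The coordinates 0, ..., d are indexed by
   'I_d.+1, and the index j in {1, ..., d} is written lift ord0 i, i : 'I_d. *)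
Definition Tmin_space (R : realType) (n : nat) : set 'rV[\bar R]_n :=
  [set x | forall j, x 0 j != -oo%E].
Arguments Tmin_space : clear implicits.

Definition supp_min (R : realType) (n : nat) (a : 'rV[\bar R]_n) : pred 'I_n :=
  fun j => a 0 j != +oo%E.

Definition supp_max (R : realType) (n : nat) (a : 'rV[\bar R]_n) : pred 'I_n :=
  fun j => a 0 j != -oo%E.

Definition mintropical_cone (R : realType) (n : nat)
    (C : set 'rV[\bar R]_n) : Prop :=
  [/\ C `<=` Tmin_space R n, C !=set0 &
      forall (x y : 'rV[\bar R]_n) (l m : \bar R),
        C x -> C y -> l != -oo%E -> m != -oo%E ->
        C (\row_j Order.min (l + x 0%R j)%E (m + y 0%R j)%E)].

Definition generates (R : realType) (n : nat) (S C : set 'rV[\bar R]_n) : Prop :=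
  [/\ mintropical_cone C, S `<=` C &
      forall D, mintropical_cone D -> S `<=` D -> C `<=` D].

Definition minimal_generating_set (R : realType) (n : nat)
    (S C : set 'rV[\bar R]_n) : Prop :=
  generates S C /\ forall S', S' `<=` S -> generates S' C -> S' = S.

(* Minimal generating sets are unique only up to tropical scaling, so every
   real scaling of an extremal generator is again one. *)
Definition extremal_generator (R : realType) (n : nat)
    (C : set 'rV[\bar R]_n) (a : 'rV[\bar R]_n) : Prop :=
  exists2 S, minimal_generating_set S C & S a.

Definition tscale (R : realType) (n : nat) (l : \bar R) (a : 'rV[\bar R]_n) :
    'rV[\bar R]_n :=
  \row_j (l + a 0%R j)%E.

Definition tmin (R : realType) (n : nat) (a b : 'rV[\bar R]_n) : 'rV[\bar R]_n :=
  \row_j Order.min (a 0 j) (b 0 j).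

Definition scaling_class (R : realType) (n : nat) (a : 'rV[\bar R]_n) :
    set 'rV[\bar R]_n :=
  [set b | exists l : R, b = tscale l%:E a].

Definition tunit (R : realType) (n : nat) (i : 'I_n) : 'rV[\bar R]_n :=
  \row_j (if j == i then 0%E else +oo%E).
Arguments tunit : clear implicits.

Definition Emin (R : realType) (d : nat) : set 'rV[\bar R]_d.+1 :=
  [set a | exists i : 'I_d, a = tunit R d.+1 (lift ord0 i)].
Arguments Emin : clear implicits.

(* The vector (0, y_1, ..., y_d). *)
Definition homog (R : realType) (d : nat) (y : 'I_d -> \bar R) :
    'rV[\bar R]_d.+1 :=
  \row_j oapp y 0%E (unlift ord0 j).

Definition embed (R : realType) (d : nat) (z : 'rV[R]_d) : 'rV[\bar R]_d.+1 :=
  homog (fun i => (z 0 i)%:E).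

Definition monomial_M (R : realType) (d : nat) (G : set 'rV[\bar R]_d.+1) :
    set 'rV[R]_d.+1 :=
  [set x | exists2 g, G g &
     ((x 0%R ord0)%:E - g 0%R ord0 <=
      \big[Order.min/+oo]_(i < d | supp_max g (lift ord0 i))
        ((x 0%R (lift ord0 i))%:E - g 0%R (lift ord0 i)))%E].

Definition cone_W (R : realType) (d : nat) (G : set 'rV[\bar R]_d.+1) :
    set 'rV[R]_d.+1 :=
  closure (~` monomial_M G).

(* The closure in the subspace T_min^(d+1) of \bar R^(d+1). *)
Definition cone_Wbar (R : realType) (d : nat) (G : set 'rV[\bar R]_d.+1) :
    set 'rV[\bar R]_d.+1 :=
  closure (map_mx EFin @` cone_W G) `&` Tmin_space R d.+1.

Definition min_gap (R : realType) (d : nat) (h a : 'rV[\bar R]_d.+1) : \bar R :=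
  (\big[Order.min/+oo]_(i < d) (a 0%R (lift ord0 i) - h 0%R (lift ord0 i)))%E.

Definition extremals_ge (R : realType) (d : nat) (A : set 'rV[\bar R]_d.+1)
    (h : 'rV[\bar R]_d.+1) : set 'rV[\bar R]_d.+1 :=
  [set a | A a /\ (min_gap h a <= a 0%R ord0)%E].

Definition new_extremals (R : realType) (d : nat) (G A : set 'rV[\bar R]_d.+1)
    (h : 'rV[\bar R]_d.+1) : set 'rV[\bar R]_d.+1 :=
  extremals_ge A h `|`
  [set a' | exists b c,
     let a := tmin (tscale (- min_gap h b)%E b) c in
     [/\ extremals_ge A h b, (A `\` extremals_ge A h) c,
         extremal_generator (cone_Wbar (G `|` [set h])) a &
         a' = homog (fun i => (a 0%R (lift ord0 i) - a 0%R ord0)%E)]].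

Definition strictly_below (R : realType) (d : nat) (z : 'rV[R]_d)
    (a : 'rV[\bar R]_d.+1) : Prop :=
  forall i : 'I_d, supp_min a (lift ord0 i) ->
    ((z 0%R i)%:E < a 0%R (lift ord0 i))%E.

(* next_nondominated Z a o: the oracle may answer o on the query (Z, a). *)
Definition next_nondominated (R : realType) (d : nat) (Z : set 'rV[R]_d)
    (a : 'rV[\bar R]_d.+1) (o : option 'rV[R]_d) : Prop :=
  match o with
  | Some z => nondominated Z z /\ strictly_below z a
  | None => ~ exists z, nondominated Z z /\ strictly_below z a
  end.

Record state (R : realType) (d : nat) := State {
  st_A : set 'rV[\bar R]_d.+1;
  st_G : set 'rV[R]_d;
  st_Omega : set 'rV[\bar R]_d.+1 }.

Definition initial_state (R : realType) (d : nat) : state R d :=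
  State (Emin R d `|` [set tunit R d.+1 ord0]) set0 (Emin R d).
Arguments initial_state : clear implicits.

(* One execution of the loop body, for some choice of a and some oracle
   answer. *)
Inductive iteration (R : realType) (d : nat) (Z : set 'rV[R]_d) :
    state R d -> state R d -> Prop :=
| iteration_point A G Omega a g :
    (A `\` Omega) a -> next_nondominated Z a (Some g) ->
    iteration Z (State A G Omega)
      (State (new_extremals (@embed R d @` G) A (embed g)) (G `|` [set g]) Omega)
| iteration_none A G Omega a :
    (A `\` Omega) a -> next_nondominated Z a None ->
    iteration Z (State A G Omega) (State A G (Omega `|` [set a])).

(* Whatever choices are made, the loop started in s never gets stuck, performs
   exactly k iterations, and the value of G upon exit is N. *)
Fixpoint returns_after (R : realType) (d : nat) (Z N : set 'rV[R]_d) (k : nat)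
    (s : state R d) : Prop :=
  match k with
  | 0 => st_A s = st_Omega s /\ st_G s = N
  | k'.+1 => [/\ st_A s <> st_Omega s, exists s', iteration Z s s' &
                 forall s', iteration Z s s' -> returns_after Z N k' s']
  end.

(* Counting classes counts extremal generators up to tropical scaling. *)
Definition nontrivial_extremal_classes (R : realType) (d : nat)
    (C : set 'rV[\bar R]_d.+1) : set (set 'rV[\bar R]_d.+1) :=
  [set K | exists a, [/\ extremal_generator C a,
     ~ (exists2 e, Emin R d e & scaling_class e a) & K = scaling_class a]].

(* Main.v *)
(* Call u in (R u {oo})^d an upper point of a finite set G if no g in G is
   strictly below u in every coordinate, and a local upper bound of G if it is a
   maximal upper point.  Dehomogenizing, W(G) consists of the upper points of G,
   so up to scaling its extremal generators are the e^(j) and the (0, u) with u a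
   local upper bound of G.  A local upper bound u of G u {h} either is one of G
   or arises from a local upper bound c > h of G by lowering one coordinate c_j
   to h_j, which is the tropical combination of (0, c) and e^(j) formed by
   NewExtremals; hence A always consists of the extremal generators for the
   current G.  A query at (0, u) either returns a point of N outside G, or shows
   that u is a local upper bound of N and moves it to Omega.  So every iteration
   decreases |N \ G| + |{local upper bounds of N} \ Omega| by one.  The loop
   cannot stop early: if z in N is not in G, then taking in every coordinate j
   the least g_j above z_j yields an upper point of G strictly above z. *)

Require Import Defs.
From mathcomp Require Import all_boot all_order all_algebra.
From mathcomp Require Import finmap.
From mathcomp Require Import all_classical all_reals all_analysis.

Set Implicit Arguments.
Unset Strict Implicit.
Unset Printing Implicit Defensive.

Import Order.TTheory GRing.Theory Num.Theory.
Import numFieldNormedType.Exports.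

Local Open Scope classical_set_scope.
Local Open Scope ring_scope.
Local Open Scope card_scope.

(** [le] is a preorder, since it will compare indices of grid points, and distinct indices can give
    the same point. In the induction, a new element [a] replaces the current candidate only if it
    satisfies [P] and lies above it; the search then restarts from [a]. *)
Lemma exists_maximal (T : finType) (le : T -> T -> Prop) (P : T -> Prop) (x : T) :
  (forall y, le y y) -> (forall y z w, le y z -> le z w -> le y w) ->
  P x -> exists y, [/\ P y, le x y & forall z, P z -> le y z -> le z y].
Proof.
move=> lexx le_trans Px.
suff [y [Py lexy ymax]] : exists y, [/\ P y, le x y &
    forall z, z \in enum T -> P z -> le y z -> le z y].
  by exists y; split=> // z; apply: ymax; rewrite mem_enum.
elim: (enum T) x Px => [|a s IHs] x Px; first by exists x.
have [y [Py lexy ymax]] := IHs x Px.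
have [[Pa leya]|Nya] := pselect (P a /\ le y a); last first.
  exists y; split=> // z; rewrite inE => /orP[/eqP-> Pa leya|]; last exact: ymax.
  by case: Nya.
have [w [Pw leaw wmax]] := IHs a Pa.
exists w; split=> //; first exact: le_trans lexy (le_trans _ _ _ leya leaw).
by move=> z; rewrite inE => /orP[/eqP->//|]; exact: wmax.
Qed.

(** * Upper points and local upper bounds of finite point sets *)

Section LocalUpperBounds.
Variables (R : realType) (d : nat).
Implicit Types (G N : set 'rV[R]_d) (h : 'rV[R]_d) (u v : 'I_d -> \bar R).

(** Coordinates may be [-oo] here, so only the order matters; [local_upper_bound_gtNy] excludes this
    value for local upper bounds of finite sets. *)
Definition upper_region G : set ('I_d -> \bar R) :=
  [set u | forall g, G g -> exists j, (u j <= (g 0%R j)%:E)%E].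

Definition local_upper_bound G : set ('I_d -> \bar R) :=
  [set u | upper_region G u /\
    forall v, upper_region G v -> (forall j, u j <= v j)%E -> v = u].

Lemma upper_region_le G u v :
  (forall j, u j <= v j)%E -> upper_region G v -> upper_region G u.
Proof. by move=> leuv Gv g /Gv[j /(le_trans (leuv j))]; exists j. Qed.

Lemma upper_regionS G G' :
  G `<=` G' -> upper_region G' `<=` upper_region G.
Proof. by move=> sGG' u G'u g /sGG'/G'u. Qed.

Lemma upper_regionU1 G h u :
  upper_region (G `|` [set h]) u <->
  upper_region G u /\ exists j, (u j <= (h 0%R j)%:E)%E.
Proof.
split=> [Ghu|[Gu hu] g [/Gu//|->//]].
split; first by apply: upper_regionS Ghu => g; left.
by apply: Ghu; right.
Qed.

Lemma notin_upper_region1 h u :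
  ~ (exists j, (u j <= (h 0%R j)%:E)%E) -> forall j, ((h 0%R j)%:E < u j)%E.
Proof. by move=> Nhu j; rewrite ltNge; apply/negP => le_uh; apply: Nhu; exists j. Qed.

Lemma fun_le_anti u v :
  (forall j, u j <= v j)%E -> (forall j, v j <= u j)%E -> u = v.
Proof. by move=> uv vu; apply/funext => j; apply/le_anti; rewrite uv vu. Qed.

(* Rounding every coordinate of a point of the upper region up to the next
   value g_j does not leave the upper region, so only the finitely many points
   with coordinates among the g_j and oo matter. *)
Definition grid_point (s : seq 'rV[R]_d) (f : {ffun 'I_d -> 'I_(size s).+1}) :
    'I_d -> \bar R :=
  fun j => nth +oo%E [seq (g 0%R j)%:E | g : 'rV[R]_d <- s] (f j).

Lemma upper_region_round (s : seq 'rV[R]_d) u :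
  upper_region [set` s] u -> exists f, upper_region [set` s] (grid_point (s := s) f) /\
    forall j, (u j <= grid_point f j)%E.
Proof.
move=> Gu.
pose v j := \big[Order.min/+oo%E]_(g <- s | (u j <= (g 0%R j)%:E)%E) (g 0%R j)%:E.
have [f fv] : exists f, v = grid_point (s := s) f.
  suff vgrid j : exists k : 'I_(size s).+1,
      v j = nth +oo%E [seq (g 0%R j)%:E | g : 'rV[R]_d <- s] k.
    have [f fv] := choice vgrid.
    by exists [ffun j => f j]; apply/funext => j; rewrite fv /grid_point ffunE.
  rewrite /v big_seq_cond; elim/big_ind: _ => [|x y [k kx] [l ly]|g /andP[gs _]].
  - by exists ord_max; rewrite nth_default// size_map.
  - by rewrite minEle; case: ifP => _; [exists k|exists l].
  have ltgs : (index g s < (size s).+1)%N by rewrite ltnS index_size.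
  exists (Ordinal ltgs); rewrite /= (nth_map 0%R) ?index_mem//.
  by rewrite nth_index.
exists f; rewrite -fv; split=> [g /= gs|j].
  have [j leug] := Gu g gs; exists j.
  exact: (bigmin_inf_seq _ g).
by apply: le_bigmin => //; rewrite leey.
Qed.

Lemma local_upper_bound_grid (s : seq 'rV[R]_d) u :
  local_upper_bound [set` s] u -> exists f, u = grid_point (s := s) f.
Proof. by move=> [/upper_region_round[f [Gf uf]] umax]; exists f; rewrite (umax _ Gf). Qed.

Lemma finite_local_upper_bound G : finite_set G -> finite_set (local_upper_bound G).
Proof.
move=> /finite_seqP[s ->].
apply: (@sub_finite_set _ _ (range (@grid_point s))); last exact/finite_image/finite_finset.
by move=> u /local_upper_bound_grid[f ->]; exists f.
Qed.

Lemma local_upper_bound_gtNy G u j :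
  finite_set G -> local_upper_bound G u -> u j != -oo%E.
Proof.
move=> /finite_seqP[s ->] /local_upper_bound_grid[f ->]; rewrite /grid_point.
have [ltfs|lesf] := ltnP (f j) (size s); first by rewrite (nth_map 0%R).
by rewrite nth_default ?size_map.
Qed.

(** Among the finitely many grid points in the upper region, take a maximal one above the rounding
    of [u]. It is maximal in the whole region because any point above it can again be rounded up to
    the grid. *)
Lemma local_upper_bound_ge G u : finite_set G -> upper_region G u ->
  exists2 v, local_upper_bound G v & forall j, (u j <= v j)%E.
Proof.
move=> /finite_seqP[s ->] Gu; have [f [Gf leuf]] := upper_region_round Gu.
have [//||v [Gv lefv vmax]] := @exists_maximal _
  (fun f f' => forall j, (grid_point (s := s) f j <= grid_point f' j)%E)
  (fun f => upper_region [set` s] (grid_point f)) f _ _ Gf.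
  by move=> x y z lexy leyz j; apply: le_trans (leyz j).
exists (grid_point v); last by move=> j; apply: le_trans (lefv j).
split=> // w Gw levw; have [k [Gk lewk]] := upper_region_round Gw.
apply: fun_le_anti => // j; apply: (le_trans (lewk j)); apply: vmax => // i.
exact: le_trans (lewk i).
Qed.

Lemma local_upper_boundS G G' u : G `<=` G' -> upper_region G' u ->
  local_upper_bound G u -> local_upper_bound G' u.
Proof. by move=> sGG' G'u [_ umax]; split=> // v /(upper_regionS sGG')/umax. Qed.

(** Choose a local upper bound [c] of [G] above [u]. If [c] survives the addition of [h], maximality
    gives u = c. Otherwise c > h everywhere, and lowering c_j to h_j at a coordinate with u_j <= h_j
    yields an upper point still above [u], hence equal to it. *)
Lemma local_upper_boundU1 G h u : finite_set G ->
  local_upper_bound (G `|` [set h]) u -> local_upper_bound G u \/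
  exists c j, [/\ local_upper_bound G c, forall i, ((h 0%R i)%:E < c i)%E &
    u = fun i => if i == j then (h 0%R j)%:E else c i].
Proof.
move=> Gfin [/upper_regionU1[Gu [j hu]] umax].
have [c Gc leuc] := local_upper_bound_ge Gfin Gu.
have [hc|/notin_upper_region1 hc] := pselect (exists j, (c j <= (h 0%R j)%:E)%E).
  by left; rewrite -(umax c)//; apply/upper_regionU1; case: Gc.
right; exists c, j; split=> //; apply/esym/umax => [|i]; last by case: eqP => [->|].
apply/upper_regionU1; split; last by exists j; rewrite eqxx.
by apply: upper_region_le (Gc.1) => i; case: eqP => // ->; exact/ltW.
Qed.

Lemma nondominated_eqP (Z : set 'rV[R]_d) G :
  finite_set G -> G `<=` nondominated Z ->
  local_upper_bound G `<=` upper_region (nondominated Z) -> G = nondominated Z.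
Proof.
move=> Gfin GN GU; apply/seteqP; split=> // z Nz; apply: contrapT => Gz.
have [s Gs] := (finite_seqP G).1 Gfin.
(* Coordinates in which no [g] exceeds [z] get the value [+oo]. *)
pose u j := \big[Order.min/+oo%E]_(g <- s | ((z 0%R j)%:E < (g 0%R j)%:E)%E) (g 0%R j)%:E.
have ltzu j : ((z 0%R j)%:E < u j)%E.
  rewrite /u; elim/big_ind: _ => // [|x y zx zy]; first exact: ltry.
  by rewrite lt_min zx zy.
have Gu : upper_region G u.
  move=> g Gg; apply: contrapT => Ngu; have [Zz _] := Nz; have [_ Ng] := GN g Gg.
  (* If g_j > z_j for some j, then g_j takes part in the minimum u_j. So a [g] strictly below [u]
     satisfies g <= z, and either dominates [z] or equals it. *)
  have gz j : (g 0 j <= z 0 j)%R.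
    rewrite leNgt; apply/negP => ltzg; apply: Ngu; exists j.
    by apply: (bigmin_inf_seq _ g); rewrite ?lte_fin//; move: Gg; rewrite Gs.
  case: (pselect (exists l, (g 0 l < z 0 l)%R)) => [ltgz|Nlt].
    by case: Nz => _; apply; exists g; split=> //; case: (GN g Gg).
  apply: Gz; suff -> : z = g by [].
  apply/rowP => j; apply/le_anti; rewrite gz andbT leNgt; apply/negP => ltgz.
  by apply: Nlt; exists j.
have [v Gv leuv] := local_upper_bound_ge Gfin Gu.
have [j] := GU v Gv z Nz; rewrite leNgt => /negP; apply.
exact: lt_le_trans (leuv j).
Qed.

End LocalUpperBounds.

(** * Irreducible elements and minimal generating sets of tropical cones *)

Section TropicalCones.
Variables (R : realType) (n : nat).
Implicit Types (C D S : set 'rV[\bar R]_n) (a b x y : 'rV[\bar R]_n) (l m : \bar R).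

Lemma tminE x y j : tmin x y 0%R j = Order.min (x 0%R j) (y 0%R j).
Proof. by rewrite mxE. Qed.

Lemma tscaleE l x j : tscale l x 0%R j = (l + x 0%R j)%E.
Proof. by rewrite mxE. Qed.

Lemma adde_minDr : right_distributive (@GRing.add \bar R) Order.min.
Proof.
move=> l x y; case: (leP x y) => [lexy|/ltW leyx]; [rewrite min_l//|rewrite min_r//];
  exact: leeD2l.
Qed.

Lemma adde_minDl : left_distributive (@GRing.add \bar R) Order.min.
Proof. by move=> x y l; rewrite ![(_ + l)%E]addeC adde_minDr. Qed.

Lemma tscale_tmin l x y : tscale l (tmin x y) = tmin (tscale l x) (tscale l y).
Proof. by apply/rowP => j; rewrite !mxE adde_minDr. Qed.

Lemma tscaleA l m x : tscale l (tscale m x) = tscale (l + m)%E x.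
Proof. by apply/rowP => j; rewrite !mxE addeA. Qed.

Lemma tscale0 x : tscale 0%E x = x.
Proof. by apply/rowP => j; rewrite !mxE add0e. Qed.

Lemma tscaleNK (r : R) x : tscale (- r%:E)%E (tscale r%:E x) = x.
Proof. by rewrite tscaleA addeC subee// tscale0. Qed.

Lemma tscaleKN (r : R) x : tscale r%:E (tscale (- r%:E)%E x) = x.
Proof. by rewrite tscaleA subee// tscale0. Qed.

Lemma tminC : commutative (@tmin R n).
Proof. by move=> x y; apply/rowP => j; rewrite !mxE minC. Qed.

Lemma tmin_idl x y : (forall j, x 0%R j <= y 0%R j)%E -> tmin x y = x.
Proof. by move=> lexy; apply/rowP => j; rewrite mxE min_l. Qed.

Lemma scaling_class_refl x : scaling_class x x.
Proof. by exists 0; rewrite tscale0. Qed.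

Lemma scaling_class_tscale (r : R) x : scaling_class (tscale r%:E x) = scaling_class x.
Proof.
apply/seteqP; split=> y [l ->]; first by exists (l + r); rewrite tscaleA.
by exists (l - r); rewrite tscaleA -EFinD subrK.
Qed.

Lemma cone_comb D l m x y : mintropical_cone D -> D x -> D y ->
  l != -oo%E -> m != -oo%E -> D (tmin (tscale l x) (tscale m y)).
Proof.
move=> [_ _ DD] Dx Dy lNy mNy.
suff -> : tmin (tscale l x) (tscale m y) = \row_j Order.min (l + x 0%R j)%E (m + y 0%R j)%E.
  exact: DD.
by apply/rowP => j; rewrite !mxE.
Qed.

Lemma cone_scale D l x : mintropical_cone D -> D x -> l != -oo%E -> D (tscale l x).
Proof.
move=> Dcone Dx lNy; rewrite -(tmin_idl (x := tscale l x) (y := tscale l x))//.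
exact: cone_comb.
Qed.

Lemma cone_tmin D x y : mintropical_cone D -> D x -> D y -> D (tmin x y).
Proof. by move=> Dcone Dx Dy; rewrite -(tscale0 x) -(tscale0 y); exact: cone_comb. Qed.

Lemma cone_infty D : mintropical_cone D -> D (const_mx +oo%E).
Proof.
move=> Dcone; have [DT [x Dx] _] := Dcone.
suff <- : tscale +oo%E x = const_mx +oo%E by exact: cone_scale.
by apply/rowP => j; rewrite !mxE addye//; exact: DT.
Qed.

(** An intrinsic description of extremality, independent of a generating set. The all-infinite
    vector is excluded because it is the tropical zero and lies in every cone. *)
Definition irreducible_in C a := [/\ C a, a <> const_mx +oo%E &
  forall x y, C x -> C y -> a = tmin x y -> a = x \/ a = y].

Lemma generates_cone S C : generates S C -> mintropical_cone C.
Proof. by case. Qed.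

Lemma Tmin_space_comb l m x y : Tmin_space R n x -> Tmin_space R n y ->
  l != -oo%E -> m != -oo%E ->
  Tmin_space R n (\row_j Order.min (l + x 0%R j) (m + y 0%R j))%E.
Proof.
move=> xT yT lNy mNy j; rewrite mxE minEle.
by case: ifP => _; rewrite adde_eq_ninfty negb_or ?lNy ?mNy; [exact: xT|exact: yT].
Qed.

(* In a decomposition of a into multiples of generators, the positive multiples
   of a itself are redundant. *)
Lemma absorb_min (a x y l m : \bar R) : a != -oo%E -> (0 < l)%E -> (0 < m)%E ->
  a = Order.min (Order.min (l + a)%E x) (Order.min (m + a)%E y) -> a = Order.min x y.
Proof.
move=> aNy l0 m0 aE; have [ay|aNoo] := eqVneq a +oo%E.
  move: aE; rewrite ay !addey ?gt_eqF ?(lt_trans (ltNyr 0))//.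
  by rewrite !minye => ->.
have afin : a \is a fin_num by rewrite fin_numE aNy aNoo.
have lt_shift k : (0 < k -> a < k + a)%E by move=> k0; rewrite -[ltLHS]add0e lteD2rE.
move: aE; rewrite minACA.
case: (leP (Order.min (l + a)%E (m + a)%E) (Order.min x y)) => // _ aE.
by move: (ltxx a); rewrite [in X in (_ < X)%O]aE lt_min !lt_shift.
Qed.

(** Every element of [C] is min(l + a, x') with x' generated by the other elements of [S]. In a =
    min(x, y), a coefficient of [a] that is at most 0 forces that term to be [a]; if both
    coefficients are positive, [a] is already generated by the others, against minimality. *)
Lemma minimal_generating_irreducible S C a :
  minimal_generating_set S C -> S a -> irreducible_in C a.
Proof.
move=> [[Ccone SC Cmin] Smin] Sa; have [CT C0 CC] := Ccone.
(* The intersection of all cones containing [S] without [a]; by minimality of [S] it misses [a]. *)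
pose span x := forall D, mintropical_cone D -> S `\ a `<=` D -> D x.
have span_sub : span `<=` C by move=> x; apply=> // y [/SC].
have spanT : span `<=` Tmin_space R n by move=> x /span_sub/CT.
have Nspan_a : ~ span a.
  move=> span_a; suff SaE : S `\ a = S by move: Sa; rewrite -SaE => -[_]; apply.
  apply: Smin => [y []//|]; split=> // [y [/SC//]|D Dcone SaD].
  by apply: Cmin => // y Sy; have [->|yNa] := pselect (y = a); [exact: span_a|exact: SaD].
have span_infty : span (const_mx +oo%E) by move=> D Dcone _; exact: cone_infty.
pose E := [set x | exists l x', [/\ l != -oo%E, span x' & x = tmin (tscale l a) x']].
have Econe : mintropical_cone E.
  split; first last.
  - move=> x y l m [l1 [x' [l1Ny sx' ->]]] [m1 [y' [m1Ny sy' ->]]] lNy mNy.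
    exists (Order.min (l + l1)%E (m + m1)%E).
    exists (\row_j Order.min (l + x' 0%R j)%E (m + y' 0%R j)%E); split.
    + rewrite minEle; case: ifP => _; rewrite adde_eq_ninfty negb_or ?lNy ?mNy//.
    + by move=> D Dcone SD; case: (Dcone) => _ _; apply=> //; [exact: sx'|exact: sy'].
    apply/rowP => j; rewrite !mxE !adde_minDr minACA.
    by rewrite !addeA -adde_minDl.
  - by exists a, 0%E, (const_mx +oo%E); split=> //; apply/rowP => j; rewrite !mxE add0e miney.
  move=> x [l [x' [lNy sx' ->]]] j; rewrite !mxE minEle; case: ifP => _; last exact: spanT.
  by rewrite adde_eq_ninfty negb_or lNy; exact/CT/SC.
have CE : C `<=` E.
  apply: Cmin => // y Sy; have [->|yNa] := pselect (y = a).
    exists 0%E, (const_mx +oo%E); split=> //.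
    by apply/rowP => j; rewrite !mxE add0e miney.
  (* The coefficient [+oo] removes [a] from the combination. *)
  exists +oo%E, y; split=> //; first by move=> D _; apply.
  by apply/rowP => j; rewrite !mxE addye ?minye//; exact/CT/SC.
split; [exact: SC|by move=> aoo; apply: Nspan_a; rewrite aoo|].
move=> x y /CE[l [x' [lNy sx' xE]]] /CE[m [y' [mNy sy' yE]]] aE.
have reduce k z z' w : (k <= 0)%E -> z = tmin (tscale k a) z' -> a = tmin z w -> a = z.
  move=> k0 zE az; apply/rowP => j; apply/le_anti/andP; split.
    by rewrite [in leLHS]az tminE ge_min lexx.
  by rewrite zE !mxE ge_min -[X in (_ <= X)%E]add0e leeD2r.
have [l0|l0] := leP l 0%E; first by left; exact: reduce l0 xE aE.
have [m0|m0] := leP m 0%E; first by right; apply: reduce m0 yE _; rewrite tminC; exact: aE.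
case: Nspan_a; suff -> : a = tmin x' y'.
  by move=> D Dcone SD; apply: cone_tmin => //; [exact: sx'|exact: sy'].
apply/rowP => j; rewrite tminE; apply: (absorb_min _ l0 m0); first exact/CT/SC.
by rewrite {1}aE tminE xE yE !mxE.
Qed.

(* The elements of a cone that are not real multiples of an irreducible
   element form a smaller cone, which cannot contain a generating set. *)
Lemma irreducible_generates S C a : generates S C -> irreducible_in C a ->
  exists2 s, S s & scaling_class a s.
Proof.
move=> [[CT C0 CC] SC Cmin] [Ca aNoo airr]; apply: contrapT => NS.
pose D := C `\` scaling_class a.
suff Dcone : mintropical_cone D.
  have [] : D a by apply: Cmin => // s Ss; split; [exact: SC|move=> sa; apply: NS; exists s].
  by move=> _; apply; exact: scaling_class_refl.
have scaling_of_scale l x (k : R) : C x -> l != -oo%E ->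
    a = tscale (k%:E + l)%E x -> scaling_class a x.
  case: l => [r||] // Cx _ ax.
    by exists (- (k + r)); rewrite ax -EFinD EFinN tscaleNK.
  by case: aNoo; rewrite ax; apply/rowP => j; rewrite !mxE addey// addye//; exact: CT.
split=> [x [/CT]//||x y l m [Cx Nx] [Cy Ny] lNy mNy].
- exists (const_mx +oo%E); split; first exact: (@cone_infty C).
  move=> [r ooE]; apply: aNoo; rewrite -[a](tscaleNK r) -ooE.
  by apply/rowP => j; rewrite !mxE addey.
split; first exact: CC.
move=> [r xyE]; have aE : a = tmin (tscale ((- r)%:E + l)%E x) (tscale ((- r)%:E + m)%E y).
  rewrite -[LHS](tscaleNK r) -xyE -!tscaleA -tscale_tmin; congr tscale.
  by apply/rowP => j; rewrite !mxE.
have shiftNy k : k != -oo%E -> ((- r)%:E + k)%E != -oo%E by rewrite adde_eq_ninfty.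
have Ccone : mintropical_cone C by [].
have [ax|ay] := airr _ _ (cone_scale Ccone Cx (shiftNy _ lNy))
  (cone_scale Ccone Cy (shiftNy _ mNy)) aE.
- exact: Nx (scaling_of_scale _ _ _ Cx lNy ax).
exact: Ny (scaling_of_scale _ _ _ Cy mNy ay).
Qed.

Lemma irreducible_tscale C a (r : R) : mintropical_cone C ->
  irreducible_in C a -> irreducible_in C (tscale r%:E a).
Proof.
move=> Ccone [Ca aNoo airr]; split; first exact: cone_scale.
  move=> raoo; apply: aNoo; rewrite -(tscaleNK r a) raoo.
  by apply/rowP => j; rewrite !mxE addey.
move=> x y Cx Cy /(congr1 (tscale (- r%:E)%E)); rewrite tscaleNK tscale_tmin => aE.
by have [->|->] := airr _ _ (cone_scale Ccone Cx (isT : (- r%:E)%E != -oo%E))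
  (cone_scale Ccone Cy (isT : (- r%:E)%E != -oo%E)) aE; rewrite tscaleKN; [left|right].
Qed.

Lemma generates_tscale S C (r : R) : generates S C -> generates (tscale r%:E @` S) C.
Proof.
move=> [Ccone SC Cmin]; split=> // [_ [s Ss <-]|D Dcone SD].
  by apply: cone_scale => //; exact: SC.
apply: Cmin => // s Ss; rewrite -(tscaleNK r s); apply: cone_scale => //.
by apply: SD; exists s.
Qed.

(** Any generating subset must contain a multiple of each irreducible [s]; as no two elements of [S]
    are proportional, that multiple is [s] itself. *)
Lemma minimal_generatingP S C : generates S C -> S `<=` irreducible_in C ->
  (forall s t, S s -> S t -> scaling_class s t -> s = t) ->
  minimal_generating_set S C.
Proof.
move=> Sgen Sirr Sinj; split=> // S' S'S S'gen; apply/seteqP; split=> // s Ss.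
have [t S't st] := irreducible_generates S'gen (Sirr _ Ss).
by rewrite (Sinj s t)//; exact: S'S.
Qed.

(** Reduces the quantification over all minimal generating sets to one known set [S]: elements of
    any such set are irreducible, hence proportional to elements of [S]. *)
Lemma extremal_generatorP S C : generates S C -> S `<=` irreducible_in C ->
  (forall s t, S s -> S t -> scaling_class s t -> s = t) ->
  forall a, extremal_generator C a <-> exists2 s, S s & scaling_class s a.
Proof.
move=> Sgen Sirr Sinj a; split=> [[T Tmin Ta]|[s Ss [r ->]]].
  have [s Ss [r sE]] := irreducible_generates Sgen (minimal_generating_irreducible Tmin Ta).
  by exists s => //; exists (- r); rewrite sE EFinN tscaleNK.
(* Rescaling all of [S] by the same [r] preserves minimality and makes the given multiple of [s] a
   member. *)
exists (tscale r%:E @` S); last by exists s.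
apply: minimal_generatingP; first exact: generates_tscale.
  by move=> _ [t St <-]; apply: irreducible_tscale; [exact: generates_cone Sgen|exact: Sirr].
move=> _ _ [t St <-] [t' St' <-]; rewrite scaling_class_tscale => -[k t'E].
rewrite (Sinj t t')//; exists (k - r).
by rewrite -[t'](tscaleNK r) t'E tscaleA -EFinN -EFinD addrC.
Qed.

End TropicalCones.

(** * The homogenized upper region and its extremal generators *)

Section UpperCone.
Variables (R : realType) (d : nat) (d_gt0 : (0 < d)%N).
Implicit Types (G : set 'rV[R]_d) (x y a : 'rV[\bar R]_d.+1) (u v : 'I_d -> \bar R).

Lemma homog0 u : homog u 0%R ord0 = 0%E.
Proof. by rewrite mxE unlift_none. Qed.

Lemma homogS u j : homog u 0%R (lift ord0 j) = u j.
Proof. by rewrite mxE liftK. Qed.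

Lemma homog_inj : injective (@homog R d).
Proof. by move=> u v uv; apply/funext => j; rewrite -homogS uv homogS. Qed.

Lemma tunit_lift0 j : tunit R d.+1 (lift ord0 j) 0%R ord0 = +oo%E.
Proof. by rewrite mxE -(inj_eq val_inj). Qed.

Lemma tunit_lift j i :
  tunit R d.+1 (lift ord0 j) 0%R (lift ord0 i) = if i == j then 0%E else +oo%E.
Proof. by rewrite mxE (inj_eq lift_inj). Qed.

Lemma row_lift0P x y : x 0%R ord0 = y 0%R ord0 ->
  (forall j, x 0%R (lift ord0 j) = y 0%R (lift ord0 j)) -> x = y.
Proof. by move=> xy0 xyS; apply/rowP => j; case: (unliftP ord0 j) => [i ->|->]. Qed.

(** The homogenization of [upper_region]: for real x_0 the condition says that the x_j - x_0 form an
    upper point, and for x_0 = oo it holds automatically once d >= 1. It serves as the explicit form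
    of the closure of W(G). *)
Definition upper_cone G : set 'rV[\bar R]_d.+1 :=
  [set x | Tmin_space R d.+1 x /\ forall g, G g -> exists j : 'I_d,
    (x 0%R (lift ord0 j) <= (g 0%R j)%:E + x 0%R ord0)%E].

Lemma upper_cone_infty G x :
  Tmin_space R d.+1 x -> x 0%R ord0 = +oo%E -> upper_cone G x.
Proof.
by move=> xT x0; split=> // g _; exists (Ordinal d_gt0); rewrite x0 addey// leey.
Qed.

Lemma upper_cone_homog G u :
  (forall j, u j != -oo%E) -> upper_region G u -> upper_cone G (homog u).
Proof.
move=> uNy Gu; split=> [j|g /Gu[j uj]]; last by exists j; rewrite homogS homog0 adde0.
by case: (unliftP ord0 j) => [i ->|->]; rewrite ?homogS ?homog0.
Qed.

Lemma upper_cone_region G x (r : R) : upper_cone G x -> x 0%R ord0 = r%:E ->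
  upper_region G (fun j => (x 0%R (lift ord0 j) - r%:E)%E).
Proof. by move=> [_ Gx] x0 g /Gx[j xj]; exists j; rewrite leeBlDr// -x0. Qed.

(** The 0th coordinate of the combination comes from one of the two points, and for each [g] the
    index that works for that point works for the combination. *)
Lemma mintropical_upper_cone G : mintropical_cone (upper_cone G).
Proof.
split=> [x []//||x y l m [xT Gx] [yT Gy] lNy mNy].
  by exists (const_mx +oo%E); apply: upper_cone_infty => [j|]; rewrite mxE.
split=> [|g Gg]; first exact: Tmin_space_comb.
have [i xi] := Gx g Gg; have [j yj] := Gy g Gg.
have shift (k a b z : \bar R) : (a <= z + b -> k + a <= z + (k + b))%E.
  by move=> ab; rewrite addeCA leeD2l.
rewrite mxE; case: (leP (l + x 0%R ord0) (m + y 0%R ord0))%E => _.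
  by exists i; rewrite mxE ge_min shift.
by exists j; rewrite mxE ge_min shift ?orbT.
Qed.

Definition upper_generators G : set 'rV[\bar R]_d.+1 :=
  Emin R d `|` [set homog u | u in local_upper_bound G].

Lemma Tmin_space_tunit n (i : 'I_n) : Tmin_space R n (tunit R n i).
Proof. by move=> j; rewrite mxE; case: ifP. Qed.

Lemma Emin_upper_cone G : Emin R d `<=` upper_cone G.
Proof.
move=> _ [i ->]; apply: upper_cone_infty; last exact: tunit_lift0.
exact: Tmin_space_tunit.
Qed.

Lemma upper_generators_cone G :
  finite_set G -> upper_generators G `<=` upper_cone G.
Proof.
move=> Gfin x [/Emin_upper_cone//|[u Gu <-]]; apply: upper_cone_homog; last exact: Gu.1.
by move=> j; exact: local_upper_bound_gtNy Gu.
Qed.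

(* Adding multiples of the e^(j) lowers the coordinates 1, ..., d at will. *)
Lemma cone_lower D x y : mintropical_cone D -> Emin R d `<=` D -> D y ->
  Tmin_space R d.+1 x -> x 0%R ord0 = y 0%R ord0 ->
  (forall j, x 0%R (lift ord0 j) <= y 0%R (lift ord0 j))%E -> D x.
Proof.
move=> Dcone ED Dy xT xy0 lexy.
(* [z s] is [y] with the coordinates in [s] already lowered to those of [x]; each further coordinate
   k costs one minimum with x_k + e^(k). *)
pose z (s : seq 'I_d) : 'rV[\bar R]_d.+1 := \row_j
  oapp (fun i => if i \in s then x 0%R j else y 0%R j) (y 0%R ord0) (unlift ord0 j).
have z0 s : z s 0%R ord0 = y 0%R ord0 by rewrite mxE unlift_none.
have zS s i : z s 0%R (lift ord0 i) =
    if i \in s then x 0%R (lift ord0 i) else y 0%R (lift ord0 i).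
  by rewrite mxE liftK.
suff Dz s : D (z s).
  suff -> : x = z (enum 'I_d) by exact: Dz.
  by apply: row_lift0P => [|i]; rewrite ?z0// zS mem_enum.
elim: s => [|k s Ds].
  by rewrite (_ : z [::] = y)//; apply: row_lift0P => [|i]; rewrite ?z0 ?zS.
have -> : z (k :: s) = tmin (z s) (tscale (x 0%R (lift ord0 k)) (tunit R d.+1 (lift ord0 k))).
  apply: row_lift0P => [|i]; rewrite tminE tscaleE ?tunit_lift0 ?tunit_lift ?z0 ?zS.
    by rewrite addey ?miney.
  rewrite inE; have [->|_] /= := eqVneq i k; last by rewrite addey ?miney.
  by rewrite adde0; case: ifP => _; rewrite ?minxx// min_r.
apply: cone_tmin => //; apply: cone_scale => //.
by apply: ED; exists k.
Qed.

Lemma upper_cone_le_generator G x (r : R) : finite_set G ->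
  upper_cone G x -> x 0%R ord0 = r%:E ->
  exists2 u, local_upper_bound G u &
    forall j, (x 0%R (lift ord0 j) <= tscale r%:E (homog u) 0%R (lift ord0 j))%E.
Proof.
move=> Gfin Gx x0.
have [u Gu leu] := local_upper_bound_ge Gfin (upper_cone_region Gx x0).
by exists u => // j; rewrite tscaleE homogS -leeBlDl// leu.
Qed.

Lemma ereal_cases (z : \bar R) : z != -oo%E -> z = +oo%E \/ exists r, z = r%:E.
Proof. by case: z => [r||]//; [right; exists r|left]. Qed.

(** By [cone_lower] it suffices to lie below a generated point with the same 0th coordinate: the
    all-infinite vector if x_0 = oo, and r + (0, u) for a suitable local upper bound [u] if x_0 =
    r. *)
Lemma upper_generators_generates G :
  finite_set G -> generates (upper_generators G) (upper_cone G).
Proof.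
move=> Gfin; split; [exact: mintropical_upper_cone|exact: upper_generators_cone|].
move=> D Dcone SD x Gx; have [xT _] := Gx.
have ED : Emin R d `<=` D by move=> e Ee; apply: SD; left.
have [x0|[r x0]] := ereal_cases (xT ord0).
  apply: (cone_lower Dcone ED (cone_infty Dcone) xT) => [|j]; first by rewrite mxE.
  by rewrite mxE leey.
have [u Gu leu] := upper_cone_le_generator Gfin Gx x0.
apply: (cone_lower Dcone ED _ xT) leu; last by rewrite tscaleE homog0 adde0.
by apply: cone_scale => //; apply: SD; right; exists u.
Qed.

Lemma upper_generators_irreducible G :
  finite_set G -> upper_generators G `<=` irreducible_in (upper_cone G).
Proof.
move=> Gfin a Ga; split; first exact: upper_generators_cone.
  case: Ga => [[i ->]|[u _ <-]] /rowP.
    by move=> /(_ (lift ord0 i)); rewrite tunit_lift eqxx mxE.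
  by move=> /(_ ord0); rewrite homog0 mxE.
move=> x y Gx Gy axy; have axyE j : a 0%R j = Order.min (x 0%R j) (y 0%R j) by rewrite axy tminE.
case: Ga => [[i ai]|[u [Gu umax] au]].
  (* The i-th coordinate of x or y is 0, all others are oo. *)
  have all_oo (z : 'rV[\bar R]_d.+1) : (forall j, a 0%R j <= z 0%R j)%E ->
      z 0%R (lift ord0 i) = a 0%R (lift ord0 i) -> a = z.
    move=> leaz zi; apply/rowP => j.
    have [->//|jNi] := eqVneq j (lift ord0 i); apply/esym/le_anti.
    by rewrite leaz andbT ai mxE (negbTE jNi) leey.
  have := axyE (lift ord0 i); rewrite minEle; case: ifP => _ azi; [left|right];
    by apply: all_oo => // j; rewrite axyE ge_min lexx ?orbT.
(* Whichever of [x], [y] attains the 0th coordinate lies above (0, u) with the same 0th coordinate,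
   so maximality of [u] identifies it with [a]. *)
have maximal (z : 'rV[\bar R]_d.+1) : upper_cone G z -> (forall j, a 0%R j <= z 0%R j)%E ->
    z 0%R ord0 = a 0%R ord0 -> a = z.
  rewrite -au homog0 => Gz leaz z0; apply: row_lift0P; first by rewrite homog0.
  move=> j; have leu k : (u k <= z 0%R (lift ord0 k) - 0%:E)%E.
    by rewrite sube0 -(homogS u).
  by rewrite homogS -(umax _ (upper_cone_region Gz z0) leu) sube0.
have := axyE ord0; rewrite minEle; case: ifP => _ az0; [left|right];
  by apply: maximal => // j; rewrite axyE ge_min lexx ?orbT.
Qed.

Lemma upper_generators_scaling G a b :
  upper_generators G a -> upper_generators G b -> scaling_class a b -> a = b.
Proof.
move=> Ga Gb [r /rowP ba].
case: Ga Gb ba => [[i ->]|[u _ <-]] [[k ->]|[v _ <-]] ba.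
- move: (ba (lift ord0 i)); rewrite tscaleE !tunit_lift eqxx adde0.
  by case: eqP => // ->.
- by move: (ba ord0); rewrite tscaleE tunit_lift0 homog0 addey.
- by move: (ba ord0); rewrite tscaleE tunit_lift0 homog0 adde0.
have r0 : r%:E = 0%E by have := ba ord0; rewrite tscaleE !homog0 adde0.
by apply/rowP => j; rewrite ba r0 tscale0.
Qed.

Lemma upper_cone_extremalP G a : finite_set G -> extremal_generator (upper_cone G) a <->
  exists2 s, upper_generators G s & scaling_class s a.
Proof.
move=> Gfin; apply: extremal_generatorP; first exact: upper_generators_generates.
- exact: upper_generators_irreducible.
- exact: upper_generators_scaling.
Qed.

End UpperCone.

(** * Identification of the closure of W(G) with the upper cone *)

Section ConeClosure.
Variables (R : realType) (d : nat) (d_gt0 : (0 < d)%N).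
Implicit Types (G : set 'rV[R]_d).

Lemma nbhs_coord (T : topologicalType) (m n : nat) (x : 'M[T]_(m, n)) i j (P : set T) :
  nbhs (x i j) P -> nbhs x [set y : 'M[T]_(m, n) | P (y i j)].
Proof.
move=> xP; exists (fun i' j' => [set u | (i' = i /\ j' = j) -> P u]).
  move=> i' j'; have [[-> ->]|ijN] := pselect (i' = i /\ j' = j).
    by apply: filterS xP => u Pu _.
  by apply: filterS (filterT) => u _ /ijN.
by move=> y; apply.
Qed.

Lemma nbhs_map_EFin (m n : nat) (x : 'M[R]_(m, n)) (B : set 'M[\bar R]_(m, n)) :
  nbhs (map_mx EFin x) B -> nbhs x [set y | B (map_mx EFin y)].
Proof.
move=> [P xP PB]; exists (fun i j => [set r | P i j r%:E]).
  by move=> i j; have := xP i j; rewrite mxE => /nbhs_EFin.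
by move=> y Py; apply: PB => i j; rewrite mxE; exact: Py.
Qed.

Lemma ereal_separate (x y : \bar R) : x != -oo%E -> (x < y)%E ->
  exists2 s : R, (x < s%:E)%E & (s%:E < y)%E.
Proof.
case: x y => [x||] [y||]// _; last by exists (x + 1); rewrite ?ltry// lte_fin ltrDl.
by rewrite lte_fin => xy; exists ((x + y) / 2); rewrite lte_fin ?midf_lt.
Qed.

(** A real [s] strictly between the two sides splits each inequality into open conditions on single
    coordinates. Consequently the failure of the [upper_cone] condition is open. *)
Lemma nbhs_above (g : 'rV[R]_d) (x : 'rV[\bar R]_d.+1) : Tmin_space R d.+1 x ->
  (forall j : 'I_d, (g 0%R j)%:E + x 0%R ord0 < x 0%R (lift ord0 j))%E ->
  nbhs x [set y : 'rV[\bar R]_d.+1 |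
    forall j : 'I_d, (g 0%R j)%:E + y 0%R ord0 < y 0%R (lift ord0 j)]%E.
Proof.
move=> xT gx; apply: (@filter_forall _ _ (fun (j : 'I_d) (y : 'rV[\bar R]_d.+1) =>
  (g 0%R j)%:E + y 0%R ord0 < y 0%R (lift ord0 j))%E (nbhs x)) => j.
have [|s gxs sx] := ereal_separate _ (gx j); first by rewrite adde_eq_ninfty negb_or xT.
have x0s : (x 0%R ord0 < s%:E - (g 0%R j)%:E)%E by rewrite lteBrDl.
have y0s := @nbhs_coord _ _ _ x 0%R ord0 _ (open_ereal_lt' x0s).
have sy := @nbhs_coord _ _ _ x 0%R (lift ord0 j) _ (open_ereal_gt' sx).
apply: filterS (filterI y0s sy) => y [y0s' sy'].
by apply: lt_trans sy'; rewrite -lteBrDl.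
Qed.

Lemma monomial_M_embedP G (x : 'rV[R]_d.+1) : monomial_M [set embed g | g in G] x <->
  exists2 g, G g & forall j : 'I_d, (g 0 j + x 0 ord0 <= x 0 (lift ord0 j))%R.
Proof.
split=> [[_ [g Gg <-]]|[g Gg gx]].
  rewrite /embed homog0 sube0 => /Order.TotalTheory.bigmin_geP[_ gx]; exists g => // j.
  by have := gx j; rewrite /supp_max homogS -EFinB lee_fin lerBrDl; apply.
exists (embed g); first by exists g.
rewrite /embed homog0 sube0; apply/Order.TotalTheory.bigmin_geP; split=> [|j _].
  by rewrite leey.
by rewrite homogS -EFinB lee_fin lerBrDl.
Qed.

Lemma near_pinfty_seq (T : eqType) (s : seq T) (c : T -> R) :
  \forall r \near +oo, forall t, t \in s -> c t < r.
Proof.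
elim: s => [|a s IHs]; first exact: nearW.
apply: filterS2 (nbhs_pinfty_gt (num_real (c a))) IHs => r ar sr t.
by rewrite inE => /orP[/eqP->//|/sr].
Qed.

Lemma real_approx (x : \bar R) (P : set \bar R) : x != -oo%E -> nbhs x P ->
  exists r : R, P r%:E /\ (x != +oo%E -> x = r%:E).
Proof.
case: x => [x||]// _; first by move/nbhs_singleton => Px; exists x.
by move=> /nbhs_ereal_pinfty[_ /filter_ex[r Pr]]; exists r.
Qed.

(** A point violating the condition for some [g] has a neighbourhood whose real points all lie in
    M(G). Conversely, a point of the upper cone is approximated by real points outside M(G): finite
    coordinates 1, ..., d are kept, infinite ones become large reals, and x_0 is raised slightly or,
    if infinite, replaced by a large real. *)
Lemma cone_Wbar_embed G : finite_set G -> cone_Wbar [set embed g | g in G] = upper_cone G.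
Proof.
move=> Gfin; apply/seteqP; split=> x.
  move=> [Wx xT]; split=> // g Gg; apply: contrapT => Ngx.
  have gx (j : 'I_d) : ((g 0%R j)%:E + x 0%R ord0 < x 0%R (lift ord0 j))%E.
    by rewrite ltNge; apply/negP => xg; apply: Ngx; exists j.
  (* Two closures are unwound in turn: the one in the extended space here, then the one in the real
     space defining W(G). *)
  have [_ [[y Wy <-] gy]] := Wx _ (nbhs_above xT gx).
  have yT : Tmin_space R d.+1 (map_mx EFin y) by move=> j; rewrite mxE.
  have [z [NMz gz]] := Wy _ (nbhs_map_EFin (nbhs_above yT gy)).
  apply: NMz; apply/monomial_M_embedP; exists g => // j.
  by have := gz j; rewrite !mxE -EFinD lte_fin => /ltW.
move=> [xT Gx]; split=> // B [P xP PB].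
have [z zE] := choice (fun j : 'I_d => real_approx (xT (lift ord0 j)) (xP 0 (lift ord0 j))).
(* Lying outside M(G) is a strict inequality for each [g], whence the freedom to choose [r] in place
   of x_0. *)
suff [r Pr Gr] : exists2 r : R, P 0 ord0 r%:E &
    forall g, G g -> exists j : 'I_d, (z j < g 0 j + r)%R.
  pose y : 'rV[R]_d.+1 := \row_j oapp z r (unlift ord0 j).
  exists (map_mx EFin y); split.
    exists y => //; apply: subset_closure => /monomial_M_embedP[g /Gr[j zj]] /(_ j).
    by rewrite !mxE liftK unlift_none /= leNgt zj.
  apply: PB => i j; rewrite !mxE (ord1 i).
  by case: (unliftP ord0 j) => [k ->|->] /=; first by case: (zE k).
have [x0|[r x0]] := ereal_cases (xT ord0); last first.
  have [r' Pr' rr'] : exists2 r', P 0 ord0 r'%:E & r < r'.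
    have := xP 0 ord0; rewrite x0 => /nbhs_EFin rP.
    have rP' : \forall s \near r^'+, P 0 ord0 s%:E by exact: cvg_within rP.
    have [s [Ps rs]] := filter_ex (filterI rP' (nbhs_right_gt r)).
    by exists s.
  exists r' => // g /Gx[j xj]; exists j.
  have xNoo : x 0%R (lift ord0 j) != +oo%E.
    by apply: contraTneq xj => ->; rewrite x0 -EFinD -ltNge ltry.
  move: xj; rewrite x0 -EFinD ((zE j).2 xNoo) lee_fin => /le_lt_trans; apply.
  by rewrite ltrD2l.
(* With x_0 = oo, one fixed coordinate serves all [g]: [r] only has to exceed finitely many
   differences. *)
have [s GE] := (finite_seqP G).1 Gfin; pose j0 := Ordinal d_gt0.
have := xP 0 ord0; rewrite x0 => /nbhs_ereal_pinfty[_ ooP].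
have [r [Pr sr]] := filter_ex (filterI ooP (near_pinfty_seq s (fun g => z j0 - g 0 j0))).
exists r => // g; rewrite GE => /sr zgr; exists j0.
by rewrite -ltrBlDl.
Qed.

End ConeClosure.

(** * Correctness of the update and the iteration count *)

Section Algorithm.
Variables (R : realType) (d : nat) (d_gt0 : (0 < d)%N).
Implicit Types (G N Z : set 'rV[R]_d) (g z : 'rV[R]_d).

Lemma extremals_ge_embedP (A : set 'rV[\bar R]_d.+1) g a : extremals_ge A (embed g) a <->
  A a /\ exists j : 'I_d, (a 0%R (lift ord0 j) <= (g 0%R j)%:E + a 0%R ord0)%E.
Proof.
split=> -[Aa]; last first.
  move=> [j aj]; split=> //; apply: Order.TotalTheory.bigmin_inf => //.
  by rewrite homogS leeBlDl; first exact: aj.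
(* The first alternative comes from the default value [+oo] of the minimum; then a_0 = oo and any
   index works. *)
move=> /bigmin_leP[ooa|[j _ aj]]; split=> //; last first.
  by exists j; move: aj; rewrite homogS leeBlDl.
exists (Ordinal d_gt0); have -> : a 0%R ord0 = +oo%E by apply/le_anti; rewrite leey.
by rewrite addey// leey.
Qed.

(** So the multiplier of b = e^(j) in NewExtremals is g_j. *)
Lemma min_gap_tunit g (j : 'I_d) :
  min_gap (embed g) (tunit R d.+1 (lift ord0 j)) = (- (g 0%R j)%:E)%E.
Proof.
apply/le_anti/andP; split.
  by apply: (Order.TotalTheory.bigmin_inf j) => //; rewrite tunit_lift eqxx homogS add0e.
apply/Order.TotalTheory.bigmin_geP; split=> [|i _]; first by rewrite leey.
by rewrite tunit_lift homogS; case: eqP => [->|_]; rewrite ?add0e// addye// leey.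
Qed.

(** Every added combination passes the extremality test, so normalization makes it a generator for
    the enlarged set. Conversely, [local_upper_boundU1] shows that pairs with [b] in [Emin] already
    produce all new local upper bounds. *)
Lemma new_extremals_upper_generators G g : finite_set G ->
  new_extremals [set embed h | h in G] (upper_generators G) (embed g) =
  upper_generators (G `|` [set g]).
Proof.
move=> Gfin; have G'fin : finite_set (G `|` [set g]) by rewrite finite_setU.
have WE : cone_Wbar ([set embed h | h in G] `|` [set embed g]) = upper_cone (G `|` [set g]).
  by rewrite -cone_Wbar_embed// image_setU image_set1.
have Emin_ge e : Emin R d e -> extremals_ge (upper_generators G) (embed g) e.
  move=> Ee; apply/extremals_ge_embedP; split; first by left.
  by exists (Ordinal d_gt0); case: Ee => i ->; rewrite tunit_lift0 addey// leey.
have homog_geP u : (exists j : 'I_d,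
    (homog u 0%R (lift ord0 j) <= (g 0%R j)%:E + homog u 0%R ord0)%E) <->
    exists j, (u j <= (g 0%R j)%:E)%E.
  by split=> -[j uj]; exists j; move: uj; rewrite homogS homog0 adde0.
apply/seteqP; split=> x.
  case=> [/extremals_ge_embedP[[Ex|[u Gu <-]] xg]|[b [c []]]]; first by left.
    right; exists u => //; apply: (local_upper_boundS _ _ Gu); first by move=> h; left.
    by apply/upper_regionU1; split; [case: Gu|exact/homog_geP].
  (* [c] fails the gap test, so it is some (0, w); hence a_0 <= 0 and [a] is no multiple of an
     e^(i). *)
  rewrite WE => _ [[/Emin_ge//|[w _ <-]] _].
  move=> /(upper_cone_extremalP d_gt0 _ G'fin)[s Gs [r aE]] ->.
  rewrite aE; case: Gs aE => [[i ->]|[v Gv <-]] aE.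
    move/rowP/(_ ord0): aE; rewrite tminE homog0 !tscaleE tunit_lift0 addey// => a0.
    by have : (+oo <= 0 :> \bar R)%E by rewrite -a0 ge_min lexx orbT.
  right; exists v => //; congr homog; apply/funext => i.
  by rewrite !tscaleE homogS homog0 adde0 addeC addeA -EFinN -EFinD addNr add0e.
move=> [|[u G'u <-]]; first by left; exact: Emin_ge.
have [Gu|[c [j [Gc gc uE]]]] := local_upper_boundU1 Gfin G'u.
  left; apply/extremals_ge_embedP; split; first by right; exists u.
  by apply/homog_geP; case: G'u => /upper_regionU1[].
right; exists (tunit R d.+1 (lift ord0 j)), (homog c).
have -> : tmin (tscale (- min_gap (embed g) (tunit R d.+1 (lift ord0 j)))%E
    (tunit R d.+1 (lift ord0 j))) (homog c) = homog u.
  rewrite min_gap_tunit oppeK; apply: row_lift0P => [|i]; rewrite tminE tscaleE.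
    by rewrite tunit_lift0 !homog0 addey// minye.
  rewrite tunit_lift !homogS uE; case: eqP => [->|_]; last by rewrite addey// minye.
  by rewrite adde0 min_l// ltW.
split; [by apply: Emin_ge; exists j| | |].
- split; first by right; exists c.
  move=> /extremals_ge_embedP[_ /homog_geP[i]]; rewrite leNgt => /negP; apply.
  exact: gc.
- rewrite WE; apply/(upper_cone_extremalP d_gt0 _ G'fin); exists (homog u).
    by right; exists u.
  exact: scaling_class_refl.
by congr homog; apply/funext => i; rewrite homogS homog0 sube0.
Qed.

Lemma iterationP Z (s s' : state R d) : iteration Z s s' -> exists2 a,
  (st_A s `\` st_Omega s) a &
  (exists2 g, next_nondominated Z a (Some g) &
    s' = State (new_extremals [set embed h | h in st_G s] (st_A s) (embed g))
      (st_G s `|` [set g]) (st_Omega s)) \/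
  (next_nondominated Z a None /\
    s' = State (st_A s) (st_G s) (st_Omega s `|` [set a])).
Proof.
case=> A G Omega a => [g|] Aa oracle; exists a => //; first by left; exists g.
by right.
Qed.

Lemma card_fset_setD1 (T : choiceType) (A : set T) x : finite_set A -> A x ->
  #|` fset_set A| = #|` fset_set (A `\ x)|.+1.
Proof.
by move=> Afin Ax; rewrite fset_setD1// (cardfsD1 x) in_fset_set// mem_set.
Qed.

Lemma card_fset_set_eq0 (T : choiceType) (A : set T) : finite_set A ->
  #|` fset_set A| = 0%N -> A = set0.
Proof.
move=> Afin A0; apply/seteqP; split=> // x Ax.
by move: A0; rewrite (card_fset_setD1 Afin Ax).
Qed.

Lemma Emin_homog u : ~ Emin R d (homog u).
Proof. by move=> [i /rowP/(_ ord0)]; rewrite homog0 tunit_lift0. Qed.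

Lemma strictly_below_homog z u : strictly_below z (homog u) <->
  forall j, ((z 0%R j)%:E < u j)%E.
Proof.
split=> zu j; last by rewrite homogS.
have [->|uNoo] := eqVneq (u j) +oo%E; first exact: ltry.
by rewrite -(homogS u); apply: zu; rewrite /supp_min homogS.
Qed.

(** The hypotheses on [s] are the loop invariants, and [k] is the quantity that drops by one per
    iteration. That [st_Omega s] consists of generators for [N] guarantees that settled elements
    survive every later update of [st_A]. *)
Lemma returns_after_upper_generators Z (k : nat) (s : state R d) :
  let N := nondominated Z in let L := [set homog u | u in local_upper_bound N] in
  finite_set N -> st_G s `<=` N -> st_A s = upper_generators (st_G s) ->
  Emin R d `<=` st_Omega s -> st_Omega s `<=` st_A s ->
  st_Omega s `<=` upper_generators N ->
  (k = #|` fset_set (N `\` st_G s)| + #|` fset_set (L `\` st_Omega s)|)%N ->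
  returns_after Z N k s.
Proof.
move=> N L Nfin; have Lfin : finite_set L by exact/finite_image/finite_local_upper_bound.
elim: k s => [|k IHk] s GN AE EO OA ON.
  move=> /esym/eqP; rewrite addn_eq0 => /andP[/eqP NG0 /eqP LO0].
  have GE : st_G s = N.
    apply/seteqP; split=> // z Nz; apply: contrapT => Gz.
    suff : (N `\` st_G s) z by rewrite (card_fset_set_eq0 _ NG0)//; exact: finite_setD.
    by [].
  split=> //; apply/seteqP; split=> // x; rewrite AE GE => -[/EO//|Lx].
  apply: contrapT => Ox; suff : (L `\` st_Omega s) x.
    by rewrite (card_fset_set_eq0 _ LO0)//; exact: finite_setD.
  by [].
move=> kE; have Gfin : finite_set (st_G s) by exact: sub_finite_set Nfin.
have ANO : st_A s <> st_Omega s.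
  (* If A = Omega, every local upper bound of the current G is one of [N], so G = [N] and both
     cardinalities vanish, contradicting a positive count. *)
  move=> AO; have GE : st_G s = N.
    apply: nondominated_eqP => // u Gu.
    have /ON[/Emin_homog//|[v [Nv _] /homog_inj <-]//] : st_Omega s (homog u).
    by rewrite -AO AE; right; exists u.
  move: kE; rewrite -AO AE GE setDv.
  rewrite (_ : L `\` _ = set0) ?fset_set0//; apply/seteqP; split=> // x [Lx Nx].
  by apply: Nx; right.
split=> //.
  have [a AOa] : (st_A s `\` st_Omega s) !=set0.
    by apply/set0P; apply: contra_not_neq ANO => AO0; apply/seteqP; split=> //; move: AO0; rewrite setD_eq0.
  case: s AOa {GN AE EO OA ON kE Gfin ANO} => A G Omega AOa.
  have [[z [Nz za]]|oracle] := pselect (exists z, nondominated Z z /\ strictly_below z a).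
    by eexists; apply: iteration_point AOa _; split; [exact: Nz|exact: za].
  by eexists; exact: iteration_none AOa oracle.
move=> s' /iterationP[a [Aa NOa]].
have [u Gu aE] : [set homog u | u in local_upper_bound (st_G s)] a.
  by move: Aa; rewrite AE => -[/EO//|].
move=> [[g [Ng /= ga] ->]|[oracle ->]].
  (* The answer is new: it lies strictly below [u], which no point of the current G does. *)
  have NGg : (N `\` st_G s) g.
    split=> // Gg; have [j] := Gu.1 g Gg; rewrite leNgt => /negP; apply.
    by move: j; apply/strictly_below_homog; rewrite aE.
  have GgN : st_G s `|` [set g] `<=` N by move=> h [/GN//|->].
  apply: IHk => //=.
  - by rewrite AE new_extremals_upper_generators.
  - rewrite AE new_extremals_upper_generators// => x Ox.
    have [Ex|[v Nv vx]] := ON _ Ox; first by left.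
    right; exists v => //.
    (* [v] is an upper point of [N], hence of the enlarged G, and was already maximal for the
       smaller G. *)
    have := OA _ Ox; rewrite AE -vx => -[/Emin_homog//|[w Gw /homog_inj wv]].
    rewrite wv in Gw; apply: local_upper_boundS Gw; first by move=> h; left.
    exact: upper_regionS GgN _ Nv.1.
  move: kE; rewrite (card_fset_setD1 (finite_setD _ Nfin) NGg) setDDl.
  by rewrite addSn => -[].
(* The answer None makes [u] an upper point of [N]; maximality is inherited from the smaller set
   G. *)
have La : L a.
  exists u => //; apply: local_upper_boundS GN _ Gu => z Nz; apply: contrapT => Nu.
  apply: oracle; exists z; split=> //; rewrite -aE; apply/strictly_below_homog.
  exact: notin_upper_region1.
apply: IHk => //=.
- by move=> x /EO; left.
- by move=> x [/OA//|->].
- by move=> x [/ON//|->]; right.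
move: kE; rewrite (card_fset_setD1 (finite_setD _ Lfin) (conj La NOa)) (setDDl L).
by rewrite addnS => -[].
Qed.

(** For empty G every point is an upper point, so the only local upper bound is (oo, ..., oo), whose
    homogenization is e^(0). *)
Lemma upper_generators_set0 :
  upper_generators (set0 : set 'rV[R]_d) = Emin R d `|` [set tunit R d.+1 ord0].
Proof.
have top_homog : homog (fun=> +oo%E) = tunit R d.+1 ord0.
  by apply: row_lift0P => [|j]; rewrite ?homog0 ?homogS mxE.
congr setU; rewrite -top_homog; apply/seteqP; split=> [_ [u [_ umax] <-]|_ ->] /=.
  by rewrite (umax (fun=> +oo%E))// => j; exact: leey.
exists (fun=> +oo%E) => //; split=> // v _ vmax.
by apply: fun_le_anti => j; [exact: leey|exact: vmax].
Qed.

Lemma nontrivial_extremal_classes_upper_cone G : finite_set G ->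
  nontrivial_extremal_classes (upper_cone G) =
  [set scaling_class a | a in [set homog u | u in local_upper_bound G]].
Proof.
move=> Gfin; apply/seteqP; split=> K.
  move=> [a [/(upper_cone_extremalP d_gt0 _ Gfin)[s [Es|Ls] sa] aN ->]].
    by case: aN; exists s.
  by exists s => //; case: sa => r ->; rewrite scaling_class_tscale.
move=> [a La <-]; exists a; split=> //.
  by apply/(upper_cone_extremalP d_gt0 _ Gfin); exists a; [right|exact: scaling_class_refl].
case: La => u _ <- [_ [i ->] [r /rowP/(_ ord0)]].
by rewrite tscaleE tunit_lift0 homog0 addey.
Qed.

End Algorithm.

Theorem theorem22 (R : realType) (d : nat) (d_ge1 : (1 <= d)%N)
    (Z : set 'rV[R]_d)
    (N_finite : finite_set (nondominated Z))
    (N_nonempty : nondominated Z !=set0)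
    (n : nat) (card_N : nondominated Z #= `I_n) :
  exists2 m : nat,
    nontrivial_extremal_classes (cone_Wbar (@embed R d @` nondominated Z)) #= `I_m &
    returns_after Z (nondominated Z) (n + m)%N (initial_state R d).
Proof.
pose L : set 'rV[\bar R]_d.+1 := [set homog u | u in local_upper_bound (nondominated Z)].
have Lfin : finite_set L by exact/finite_image/finite_local_upper_bound.
have [m Lm] := (finite_setP L).1 Lfin; exists m.
  rewrite cone_Wbar_embed// nontrivial_extremal_classes_upper_cone//.
  (* Distinct local upper bounds give distinct scaling classes, so classes may be counted by [L]. *)
  apply: card_eq_trans Lm; apply: inj_card_eq => a b /set_mem La /set_mem Lb ab.
  apply: (@upper_generators_scaling _ _ (nondominated Z)); [by right|by right|].
  by rewrite ab; exact: scaling_class_refl.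
have EL : L `\` Emin R d = L.
  by apply/seteqP; split=> [x []//|x Lx]; split=> //; case: Lx => u _ <-; exact: Emin_homog.
apply: returns_after_upper_generators => //=.
- by rewrite upper_generators_set0.
- by move=> x; left.
(* At the start G is empty and Omega = [Emin] is disjoint from [L], so the count is n + m. *)
by rewrite setD0 (card_fset_set card_N) -/L EL (card_fset_set Lm).
Qed.
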